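(* For every integer $h\ge 1$, the positive odd integers of the form $4m+3$ ($m\ge 0$) whose Alpha1 Trajectory Length equals $h$ are exactly the integers $$x_{h,n}=2^{h+1}(2n-1)-1,\qquad n=1,2,3,\ldots,$$ and every integer of the form $4m+3$ ($m\ge 0$) is equal to $x_{h,n}$ for some integers $h\ge 1$ and $n\ge 1$.
   Context: For a positive odd integer $x$, its Collatz iterate is the odd integer $y=(3x+1)/2^{\alpha}$, where $\alpha$ is the (unique) positive integer making $y$ an odd integer; one says that $x$ uses this value of $\alpha$. The Collatz trajectory of $x$ is the sequence starting with $x$ in which each term after the first is the Collatz iterate of the preceding term. For $x$ of the form $4m+3$, the Alpha1 Trajectory Length of $x$ is the number of consecutive terms of the trajectory, counted from and including $x$ itself, that use $\alpha=1$, before the first term that uses $\alpha\ge 2$. For example, the trajectory of $63$ begins $63, 95, 143, 215, 323, 485, 91,\ldots$, where $63,95,143,215,323$ use $\alpha=1$ and $485$ uses $\alpha=4$, so the Alpha1 Trajectory Length of $63$ is $5$. *)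

(* Defs.v *)
From mathcomp Require Import all_boot.

Set Implicit Arguments.
Unset Strict Implicit.
Unset Printing Implicit Defensive.

(* The conditions force x to be odd: for x even, 3 * x + 1 is odd and no
   positive a qualifies. *)
Definition uses_alpha (x a : nat) : bool :=
  [&& 0 < a, 2 ^ a %| 3 * x + 1 & odd ((3 * x + 1) %/ 2 ^ a)].

Definition collatz_iterate (x y : nat) : Prop :=
  exists2 a, uses_alpha x a & y = (3 * x + 1) %/ 2 ^ a.

Definition collatz_trajectory (x : nat) (t : nat -> nat) : Prop :=
  t 0 = x /\ forall i, collatz_iterate (t i) (t i.+1).

(* The length is a relation, so that termination of the initial run of terms
   using alpha = 1 is not presupposed. *)
Definition alpha1_trajectory_length (x h : nat) : Prop :=
  exists t, [/\ collatz_trajectory x t,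
                forall i, i < h -> uses_alpha (t i) 1
              & exists2 a, 2 <= a & uses_alpha (t h) a].

Lemma uses_alphaE x a :
  odd x -> uses_alpha x a = (a == logn 2 (3 * x + 1)).
Proof.
move=> ox; have e3 : ~~ odd (3 * x + 1) by rewrite addn1 /= oddM ox.
have p3 : 0 < 3 * x + 1 by rewrite addn1.
have lg : 0 < logn 2 (3 * x + 1) by rewrite logn_gt0 mem_primes p3 dvdn2 e3.
apply/idP/eqP => [/and3P[_ /dvdnP[q e]]|->].
  rewrite e mulnK ?expn_gt0 // => oq.
  rewrite lognM ?(odd_gt0 oq) ?expn_gt0 // pfactorK //.
  by rewrite [logn 2 q]logn_coprime // coprime2n.
rewrite /uses_alpha lg pfactor_dvdnn /=.
have [q cq {1}->] := @pfactor_coprime 2 (3 * x + 1) isT p3.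
by rewrite mulnK ?expn_gt0 // -coprime2n.
Qed.

Lemma alpha1_trajectory_length_inj x h k :
  alpha1_trajectory_length x h -> alpha1_trajectory_length x k -> h = k.
Proof.
have od y a : uses_alpha y a -> odd y.
  case/and3P=> a0 d _; have: 2 %| 3 * y + 1.
    by apply: dvdn_trans d; rewrite -{1}[2]expn1 dvdn_exp2l.
  by rewrite dvdn2 addn1 /= oddM /= negbK.
have un y a b : uses_alpha y a -> uses_alpha y b -> a = b.
  by move=> ha; have oy := od _ _ ha; move: ha; rewrite !uses_alphaE // => /eqP -> /eqP ->.
move=> [t [[t0 tS] t1 [a a2 ta]]] [u [[u0 uS] u1 [b b2 ub]]].
have tu i : t i = u i.
  elim: i => [|i IH]; first by rewrite t0 u0.
  have [c tc ->] := tS i; have [d ud ->] := uS i.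
  by rewrite IH in tc *; rewrite (un _ _ _ tc ud).
case: (ltngtP h k) => // [lt|lt].
  by have := u1 _ lt; rewrite -tu => /(un _ _ _ ta) e; rewrite e in a2.
by have := t1 _ lt; rewrite tu => /(un _ _ _ ub) e; rewrite e in b2.
Qed.

(* Main.v *)
Require Import Defs.
From mathcomp Require Import all_boot.
From mathcomp Require Import zify.

(** The length is read off the 2-adic valuation of [x + 1].  When [4 %| x + 1],
    the term [x] uses alpha equal to [1] and its iterate [y] satisfies
    [y + 1 = 3 * (x + 1) / 2]: the run of ones removes one factor [2] at each
    term and only alters the odd cofactor.  It stops exactly when one factor [2]
    is left, since then [3 * x + 1] is divisible by [4].  Hence
    [x = 2 ^ (h + 1) * q - 1] with [q] odd has length [h]
    ([alpha1_trajectory_length_odd_cofactor]).  Conversely, [4 * m + 4] is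
    a power [2 ^ (k + 1)] with [1 <= k] times an odd number
    ([four_mul_add3_odd_cofactor]), so [4 * m + 3] has length [k]; as lengths are
    unique, [k] is the given one. *)

Lemma uses_alpha_logn x : odd x -> uses_alpha x (logn 2 (3 * x + 1)).
Proof. by move=> ox; rewrite uses_alphaE. Qed.

Lemma collatz_trajectory_exists x :
  odd x -> exists t, collatz_trajectory x t.
Proof.
move=> ox; pose step y := (3 * y + 1) %/ 2 ^ logn 2 (3 * y + 1).
have odd_iter i : odd (iter i step x).
  elim: i => [//|i IH].
  by have /and3P[_ _] := uses_alpha_logn _ IH; rewrite iterS.
exists (fun i => iter i step x); split=> // i; rewrite iterS.
by exists (logn 2 (3 * iter i step x + 1)); first exact: uses_alpha_logn.
Qed.

Lemma alpha1_trajectory_length0 x a :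
  odd x -> 1 < a -> uses_alpha x a -> alpha1_trajectory_length x 0.
Proof.
move=> ox a2 xa; have [t tx] := collatz_trajectory_exists _ ox.
by exists t; split=> //; exists a; rewrite ?tx.1.
Qed.

Lemma alpha1_trajectory_lengthS x h :
  uses_alpha x 1 -> alpha1_trajectory_length ((3 * x + 1) %/ 2 ^ 1) h ->
  alpha1_trajectory_length x h.+1.
Proof.
move=> x1 [t [[t0 tS] t1 th]].
exists (fun i => if i is j.+1 then t j else x); split=> //.
- by split=> // -[|i] //; exists 1; rewrite ?t0.
- by case=> [//|i] /t1.
Qed.

(** In the induction on [h] the cofactor [q] becomes [3 * q] at the next term,
    and stays odd. *)
Lemma alpha1_trajectory_length_odd_cofactor h q :
  odd q -> alpha1_trajectory_length (2 ^ h.+1 * q - 1) h.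
Proof.
elim: h q => [|h IH] q oq.
  have eq : q = (q./2).*2.+1 by rewrite -[LHS]odd_double_half oq.
  have ox : odd (2 ^ 1 * q - 1) by rewrite expn1; lia.
  apply: (alpha1_trajectory_length0 _ _ ox _ (uses_alpha_logn _ ox)).
  have -> : 3 * (2 ^ 1 * q - 1) + 1 = 2 ^ 2 * (3 * q./2 + 1).
    by rewrite expn1; lia.
  by rewrite -(@pfactor_dvdn 2 2) ?(dvdn_mulr _ (dvdnn _)) // addn1.
have p_gt0 : 0 < 2 ^ h.+1 * q by rewrite muln_gt0 expn_gt0 (odd_gt0 oq).
have e : 3 * (2 ^ h.+2 * q - 1) + 1 = (2 ^ h.+1 * (3 * q) - 1) * 2 ^ 1.
  by rewrite [2 ^ h.+2]expnS mulnCA -mulnA; lia.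
have oy : odd (2 ^ h.+1 * (3 * q) - 1).
  by rewrite oddB ?oddM ?oddX //; lia.
apply: alpha1_trajectory_lengthS.
  by rewrite /uses_alpha e dvdn_mull // mulnK.
by rewrite e mulnK //; apply: IH; rewrite oddM.
Qed.

Lemma four_mul_add3_odd_cofactor m :
  exists h n, [/\ 1 <= h, 1 <= n & 4 * m + 3 = 2 ^ (h + 1) * (2 * n - 1) - 1].
Proof.
have [q cq e] := @pfactor_coprime 2 (4 * m + 4) isT ltac:(lia).
have oq : odd q by rewrite -coprime2n.
have k2 : 1 < logn 2 (4 * m + 4).
  by rewrite -(@pfactor_dvdn 2 2) //; lia.
exists (logn 2 (4 * m + 4)).-1, (q./2).+1; split; [lia | by [] |].
have -> : 2 * (q./2).+1 - 1 = q by lia.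
have -> : (logn 2 (4 * m + 4)).-1 + 1 = logn 2 (4 * m + 4) by lia.
by rewrite [2 ^ _ * q]mulnC -e; lia.
Qed.

Theorem mainTheorem2 :
  (forall h : nat, 1 <= h -> forall x : nat,
     ((exists m : nat, x = 4 * m + 3) /\ alpha1_trajectory_length x h)
     <-> (exists n : nat, 1 <= n /\ x = 2 ^ (h + 1) * (2 * n - 1) - 1))
  /\
  (forall m : nat, exists h n : nat,
     [/\ 1 <= h, 1 <= n & 4 * m + 3 = 2 ^ (h + 1) * (2 * n - 1) - 1]).
Proof.
have len h n : 1 <= n ->
    alpha1_trajectory_length (2 ^ (h + 1) * (2 * n - 1) - 1) h.
  move=> n1; rewrite addn1; apply: alpha1_trajectory_length_odd_cofactor; lia.
split; last exact: four_mul_add3_odd_cofactor.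
move=> h h1 x; split=> [[[m ->] xh]|[n [n1 ->]]].
  have [k [n [_ n1 e]]] := four_mul_add3_odd_cofactor m.
  exists n; split=> //; rewrite e in xh *.
  by rewrite (alpha1_trajectory_length_inj xh (len k n n1)).
split; last exact: len.
case: h h1 => // h _; exists (2 ^ h * (2 * n - 1)).-1.
have : 0 < 2 ^ h * (2 * n - 1) by rewrite muln_gt0 expn_gt0; lia.
by rewrite addn1 !expnS -!mulnA; lia.
Qed.
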